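(* Let $K$ be a field. Given integers $t$ and $n$ such that $6\leq t\leq n+1$, there exists a finite connected graph $G$ on the vertex set $[n]$ such that $\operatorname{depth}(S/J_G)=t$, where $S=K[x_1,\ldots,x_n,y_1,\ldots,y_n]$ and $J_G\subset S$ is the binomial edge ideal of $G$.
   Context: All graphs are finite, with no loops, no multiple edges and no isolated vertices. The binomial edge ideal of a graph $G$ on $[n]=\{1,\ldots,n\}$ with edge set $E(G)$ is the ideal $J_G$ of $S=K[x_1,\ldots,x_n,y_1,\ldots,y_n]$ generated by the binomials $x_iy_j-x_jy_i$ with $i<j$ and $\{i,j\}\in E(G)$. The depth of $S/J_G$ is its depth as a finitely generated graded $S$-module (with respect to the homogeneous maximal ideal of $S$). *)

(* Defs.v *)
From mathcomp Require Import all_boot all_order all_algebra.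
From mathcomp Require Import mpoly.

Set Implicit Arguments.
Unset Strict Implicit.
Unset Printing Implicit Defensive.

Import GRing.Theory.
Local Open Scope ring_scope.

Record graph (V : finType) := Graph {
  edge :> rel V;
  edge_sym : ssrbool.symmetric edge;
  edge_irrefl : irreflexive edge;
  edge_not_isolated : forall v, exists w, edge v w
}.

Definition connected_graph (V : finType) (G : graph V) : Prop :=
  forall v w : V, connect G v w.

Section Depth.
Variable R : comNzRingType.

Definition ideal_gen (P : R -> Prop) (r : R) : Prop :=
  exists2 s : seq (R * R),
    (forall c, c \in s -> P c.2) & r = \sum_(c <- s) c.1 * c.2.

Definition ideal_adjoin (I : R -> Prop) (fs : seq R) : R -> Prop :=
  ideal_gen (fun r => I r \/ r \in fs).

(* For an ideal I, [fs] is a regular sequence on the module M = R / I, with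
   statements about M / (f_0, ..., f_(i-1)) M = R / (I + (f_0, ..., f_(i-1)))
   read off in R: multiplication by f_i is injective on this quotient for every
   i, and M / (fs) M is nonzero. *)
Definition regular_seq (I : R -> Prop) (fs : seq R) : Prop :=
  (forall i, (i < size fs)%N ->
     forall g, ideal_adjoin I (take i fs) (fs`_i * g) ->
               ideal_adjoin I (take i fs) g)
  /\ ~ ideal_adjoin I fs 1.

(* The depth of R / I with respect to the ideal m is d, i.e., d is the largest
   length of a sequence of elements of m that is regular on R / I. *)
Definition depth_quotient_eq (m I : R -> Prop) (d : nat) : Prop :=
  (exists fs : seq R,
     [/\ size fs = d, forall f, f \in fs -> m f & regular_seq I fs])
  /\ (forall fs : seq R,
        (forall f, f \in fs -> m f) -> regular_seq I fs -> (size fs <= d)%N).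

End Depth.

Definition homogeneous_max_ideal (K : fieldType) (m : nat) :
    {mpoly K[m]} -> Prop :=
  ideal_gen (fun p => exists i : 'I_m, p = 'X_i).

Section BinomialEdgeIdeal.
Variables (K : fieldType) (n : nat).

(* The ring S = K[x_1, ..., x_n, y_1, ..., y_n] is {mpoly K[n + n]}, the x's
   being the first n variables; vertices and variables are numbered from 0. *)
Definition xvar (i : 'I_n) : {mpoly K[n + n]} := 'X_(lshift n i).
Definition yvar (i : 'I_n) : {mpoly K[n + n]} := 'X_(rshift n i).

Definition binomial_edge_ideal (G : graph 'I_n) : {mpoly K[n + n]} -> Prop :=
  ideal_gen (fun p => exists i j : 'I_n,
    [/\ (i < j)%N, G i j & p = xvar i * yvar j - xvar j * yvar i]).

End BinomialEdgeIdeal.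

(* Main.v *)
(* The graph joins n + 2 - t vertices, adjacent to everything, to an independent
   set of t - 2 vertices. Its ideal is J = A n B, with A the ideal of 2-minors of
   the generic 2 x n matrix and B generated by the variables of the first group.
   Here S/A has depth n + 1, S/B is a polynomial ring in 2(t - 2) variables and
   S/(A + B), a determinantal ring on t - 2 vertices, has depth t - 1, so the
   sequence 0 -> S/J -> S/A x S/B -> S/(A + B) -> 0 gives depth t.

   To make this explicit, the t - 1 linear forms x_(j+1) - y_j (x_n = 0) with
   j >= n + 1 - t are regular on all three quotients, and x_0 + y_(n-2) extends
   them on S/A and S/B, hence on S/J. On the determinantal rings one starts with
   x_k, a nonzerodivisor; modulo x_k the ideal splits as an intersection again,
   and gradedness allows one to move x_k to the end. The class of a variable is
   in the socle of S/(A + B) modulo the forms, and the snake lemma turns it into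
   a socle element of S/J modulo the whole sequence; by vanishing of Koszul cohomology no regular
   sequence is then longer. *)
Require Import Defs.
From mathcomp Require Import all_boot all_order all_algebra.
From mathcomp Require Import mpoly.
From mathcomp Require Import ring zify.
From Stdlib Require Import IndefiniteDescription.

Set Implicit Arguments.
Unset Strict Implicit.
Unset Printing Implicit Defensive.

Import GRing.Theory.
Local Open Scope ring_scope.

(** * Regular sequences on quotients *)

Section Ideals.
Variable R : comNzRingType.
Implicit Types (I J P : R -> Prop) (f g p q r u : R) (fs gs : seq R).

Record is_ideal I : Prop := IsIdeal {
  ideal0 : I 0;
  idealD : forall p q, I p -> I q -> I (p + q);
  ideal_mull : forall r p, I p -> I (r * p) }.

Lemma ideal_mulr I (hI : is_ideal I) r p : I p -> I (p * r).
Proof. by rewrite mulrC; apply: ideal_mull. Qed.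

Lemma idealN I (hI : is_ideal I) p : I p -> I (- p).
Proof. by rewrite -mulN1r; apply: ideal_mull. Qed.

Lemma idealB I (hI : is_ideal I) p q : I p -> I q -> I (p - q).
Proof. by move=> hp hq; apply: idealD => //; apply: idealN. Qed.

Lemma ideal_congr I (hI : is_ideal I) p q : I (p - q) -> I p <-> I q.
Proof.
move=> hpq; split=> h.
  have -> : q = p - (p - q) by ring.
  exact: idealB.
have -> : p = (p - q) + q by ring.
exact: idealD.
Qed.

Lemma ideal_sum I (hI : is_ideal I) (T : eqType) (s : seq T) (F : T -> R) :
  (forall c, c \in s -> I (F c)) -> I (\sum_(c <- s) F c).
Proof.
move=> h; rewrite big_seq; apply: (big_ind I) => //; first exact: ideal0.
by move=> p q; apply: idealD.
Qed.

Lemma is_ideal_gen P : is_ideal (ideal_gen P).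
Proof.
split.
- by exists [::] => //; rewrite big_nil.
- move=> p q [s hs ->] [s' hs' ->]; exists (s ++ s'); last by rewrite big_cat.
  by move=> c; rewrite mem_cat => /orP[/hs|/hs'].
- move=> r p [s hs ->]; exists [seq (r * c.1, c.2) | c <- s].
    by move=> c /mapP[d /hs hd ->].
  by rewrite big_map mulr_sumr; apply: eq_bigr => c _; rewrite mulrA.
Qed.

Lemma mem_ideal_gen P p : P p -> ideal_gen P p.
Proof.
move=> hp; exists [:: (1, p)]; first by move=> c; rewrite inE => /eqP ->.
by rewrite big_seq1 mul1r.
Qed.

Lemma ideal_gen_le P I : is_ideal I -> (forall p, P p -> I p) ->
  forall p, ideal_gen P p -> I p.
Proof.
move=> hI h p [s hs ->]; apply: ideal_sum => // c /hs /h; exact: ideal_mull.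
Qed.

(** * Intersections, sums and adjunction of elements *)

Definition ideal_cap I J p := I p /\ J p.
Definition ideal_add I J p := exists2 q, I q & J (p - q).
(** A single cofactor replaces the list of coefficients in [ideal_adjoin], and [adjs] iterates from
    the head, which suits induction on the sequence. *)
Definition adj I f p := exists a, I (p - a * f).
Definition adjs := foldl adj.

Lemma is_ideal_cap I J : is_ideal I -> is_ideal J -> is_ideal (ideal_cap I J).
Proof.
move=> hI hJ; split; first by split; apply: ideal0.
- by move=> p q [? ?] [? ?]; split; apply: idealD.
- by move=> r p [? ?]; split; apply: ideal_mull.
Qed.

Lemma is_ideal_adj I f : is_ideal I -> is_ideal (adj I f).
Proof.
move=> hI; split.
- by exists 0; rewrite mul0r subrr; apply: ideal0.
- move=> p q [a ha] [b hb]; exists (a + b).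
  have -> : p + q - (a + b) * f = (p - a * f) + (q - b * f) by ring.
  exact: idealD.
- move=> r p [a ha]; exists (r * a).
  have -> : r * p - r * a * f = r * (p - a * f) by ring.
  exact: ideal_mull.
Qed.

Lemma is_ideal_add I J : is_ideal I -> is_ideal J -> is_ideal (ideal_add I J).
Proof.
move=> hI hJ; split.
- by exists 0; [|rewrite subr0]; apply: ideal0.
- move=> p q [a ha hpa] [b hb hqb]; exists (a + b); first exact: idealD.
  have -> : p + q - (a + b) = (p - a) + (q - b) by ring.
  exact: idealD.
- move=> r p [a ha hpa]; exists (r * a); first exact: ideal_mull.
  by rewrite -mulrBr; apply: ideal_mull.
Qed.

Lemma ideal_addl I J p : is_ideal J -> I p -> ideal_add I J p.
Proof. by move=> hJ hp; exists p => //; rewrite subrr; apply: ideal0. Qed.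

Lemma ideal_addr I J p : is_ideal I -> J p -> ideal_add I J p.
Proof. by move=> hI hp; exists 0; [apply: ideal0|rewrite subr0]. Qed.

Lemma ideal_add_le I1 I2 J p : is_ideal J -> (forall p, I1 p -> J p) ->
  (forall p, I2 p -> J p) -> ideal_add I1 I2 p -> J p.
Proof.
by move=> hJ h1 h2 [q /h1 hq /h2 hpq]; rewrite -(subrK q p); apply: idealD.
Qed.

Lemma adj_sub I f p : I p -> adj I f p.
Proof. by exists 0; rewrite mul0r subr0. Qed.

Lemma adj_mem I f : is_ideal I -> adj I f f.
Proof. by move=> hI; exists 1; rewrite mul1r subrr; apply: ideal0. Qed.

Lemma adj_le I J f : is_ideal J -> (forall p, I p -> J p) -> J f ->
  forall p, adj I f p -> J p.
Proof.
move=> hJ h hf p [a /h ha]; have -> : p = (p - a * f) + a * f by ring.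
by apply: idealD => //; apply: ideal_mull.
Qed.

Lemma adj_mono I J f p : (forall p, I p -> J p) -> adj I f p -> adj J f p.
Proof. by move=> h [a /h ha]; exists a. Qed.

Lemma is_ideal_adjs I fs : is_ideal I -> is_ideal (adjs I fs).
Proof. by elim: fs I => //= f fs IH I hI; apply/IH/is_ideal_adj. Qed.

Lemma adjs_sub I fs p : I p -> adjs I fs p.
Proof. by elim: fs I => //= f fs IH I hI; apply/IH/adj_sub. Qed.

Lemma adjs_mem I fs f : is_ideal I -> f \in fs -> adjs I fs f.
Proof.
elim: fs I => //= g fs IH I hI; rewrite inE => /orP[/eqP ->|hf].
  by apply/adjs_sub/adj_mem.
by apply: IH => //; apply: is_ideal_adj.
Qed.

Lemma adjs_le I J fs : is_ideal J -> (forall p, I p -> J p) ->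
  (forall f, f \in fs -> J f) -> forall p, adjs I fs p -> J p.
Proof.
elim: fs I => //= f fs IH I hJ h hfs; apply: IH => //.
  by apply: adj_le => //; apply: hfs; rewrite inE eqxx.
by move=> g hg; apply: hfs; rewrite inE hg orbT.
Qed.

Lemma ideal_adjoinE I fs : is_ideal I ->
  forall p, ideal_adjoin I fs p <-> adjs I fs p.
Proof.
move=> hI p; split.
  apply: ideal_gen_le; first exact: is_ideal_adjs.
  by move=> q [?|?]; [apply: adjs_sub | apply: adjs_mem].
apply: adjs_le; first exact: is_ideal_gen.
  by move=> q hq; apply: mem_ideal_gen; left.
by move=> f hf; apply: mem_ideal_gen; right.
Qed.

(** * Weakly regular sequences and intersections of ideals *)

Definition nonzerodivisor I f := forall g, I (f * g) -> I g.

(** Only the injectivity half of [regular_seq], so that sequences can be cut and concatenated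
    freely; properness is proved separately, from an element outside the ideal. *)
Fixpoint wreg I fs : Prop :=
  if fs is f :: fs' then nonzerodivisor I f /\ wreg (adj I f) fs' else True.

(** Since (f - z)(f + z) = f^2 - z^2, an element killed by f + z modulo I is killed by f^2. *)
Lemma nonzerodivisor_add_sqr0 I f z : is_ideal I -> nonzerodivisor I f ->
  I (z * z) -> nonzerodivisor I (f + z).
Proof.
move=> hI hf hz g hg; apply: (hf); apply: (hf).
have -> : f * (f * g) = (f - z) * ((f + z) * g) + z * z * g by ring.
by apply: idealD => //; [apply: ideal_mull | apply: ideal_mulr].
Qed.

Lemma nonzerodivisor_ext I J f : (forall p, I p <-> J p) ->
  nonzerodivisor I f -> nonzerodivisor J f.
Proof. by move=> h hf g /h /hf /h. Qed.

Lemma nonzerodivisor_congr I f g : is_ideal I -> I (f - g) ->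
  nonzerodivisor I f -> nonzerodivisor I g.
Proof.
move=> hI hfg hf r hr; apply: hf.
have -> : f * r = (f - g) * r + g * r by ring.
by apply: idealD => //; apply: ideal_mulr.
Qed.

Lemma wreg_ext I J fs : (forall p, I p <-> J p) -> wreg I fs -> wreg J fs.
Proof.
elim: fs I J => //= f fs IH I J h [hf hfs]; split.
  exact: nonzerodivisor_ext hf.
by apply: IH hfs => p; split; apply: adj_mono => q /h.
Qed.

Lemma adjs_cat I fs gs : adjs I (fs ++ gs) = adjs (adjs I fs) gs.
Proof. exact: foldl_cat. Qed.

Lemma wreg_cat I fs gs : wreg I (fs ++ gs) <-> wreg I fs /\ wreg (adjs I fs) gs.
Proof.
elim: fs I => [|f fs IH] I /=; first by split=> [|[]].
by split=> [[hf /IH[? ?]]|[[? ?] ?]]; do ?split=> //; apply/IH.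
Qed.

Lemma wreg_rcons I fs f :
  wreg I (rcons fs f) <-> wreg I fs /\ nonzerodivisor (adjs I fs) f.
Proof.
rewrite -cats1; split=> [/wreg_cat[? []]|[? ?]] //.
by apply/wreg_cat; split.
Qed.

Lemma wreg_rcons_congr I fs f g : is_ideal I -> I (f - g) ->
  wreg I (rcons fs f) -> wreg I (rcons fs g).
Proof.
move=> hI hfg /wreg_rcons[h1 h2]; apply/wreg_rcons; split => //.
by apply: nonzerodivisor_congr h2; [apply: is_ideal_adjs|apply: adjs_sub].
Qed.

Lemma regular_seq_wreg I fs : is_ideal I -> regular_seq I fs -> wreg I fs.
Proof.
move=> hI [h _]; elim/last_ind: fs h => // fs f IH h; apply/wreg_rcons; split.
  apply: IH => i hi g; have := h i; rewrite size_rcons ltnS => /(_ (ltnW hi) g).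
  by rewrite nth_rcons hi -cats1 takel_cat // ltnW.
have := h (size fs); rewrite size_rcons => /(_ (leqnn _)).
rewrite nth_rcons ltnn eqxx -cats1 take_size_cat // => hf g hg.
by apply/ideal_adjoinE/hf/ideal_adjoinE.
Qed.

Lemma wreg_regular_seq I fs : is_ideal I -> wreg I fs -> ~ adjs I fs 1 ->
  regular_seq I fs.
Proof.
move=> hI h h1; split; last by move=> /(ideal_adjoinE _ hI).
move=> i hi g /ideal_adjoinE hg; apply/ideal_adjoinE => //; move: hg.
have := h; rewrite -{1}(cat_take_drop i fs) => /wreg_cat[_].
by rewrite (drop_nth 0 hi) /= => -[hf _] hg; apply/hf/hg.
Qed.

(* The sequence 0 -> R/(I n J) -> R/I x R/J -> R/(I+J) -> 0 stays exact modulo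
   an element which is regular on R/(I+J); the induction repeats this. *)
Lemma adj_cap I J f : is_ideal I -> is_ideal J ->
  nonzerodivisor (ideal_add I J) f ->
  forall p, adj (ideal_cap I J) f p <-> ideal_cap (adj I f) (adj J f) p.
Proof.
move=> hI hJ hf p; split=> [[a [h1 h2]]|[[a ha] [b hb]]].
  by split; exists a.
have /hf [q hq hab] : ideal_add I J (f * (a - b)).
  exists (- (p - a * f)); first exact: idealN.
  by have -> : f * (a - b) - - (p - a * f) = p - b * f by ring.
exists (a - q); split.
  have -> : p - (a - q) * f = p - a * f + q * f by ring.
  by apply: idealD => //; apply: ideal_mulr.
have -> : p - (a - q) * f = (p - b * f) - (a - b - q) * f by ring.
by apply: idealB => //; apply: ideal_mulr.
Qed.

Lemma adj_add I J f : is_ideal I -> is_ideal J ->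
  forall p, adj (ideal_add I J) f p <-> ideal_add (adj I f) (adj J f) p.
Proof.
move=> hI hJ p; split.
  move=> [a [q hq h]]; exists q; first exact: adj_sub.
  by exists a; have -> : p - q - a * f = p - a * f - q by ring.
move=> [q [a ha] [b hb]]; exists (a + b); exists (q - a * f) => //.
by have -> : p - (a + b) * f - (q - a * f) = p - q - b * f by ring.
Qed.

Lemma adjs_ext I J fs : (forall p, I p <-> J p) ->
  forall p, adjs I fs p <-> adjs J fs p.
Proof.
elim: fs I J => //= f fs IH I J h; apply: IH => p.
by split; apply: adj_mono => q /h.
Qed.

Lemma adjs_add I J fs : is_ideal I -> is_ideal J ->
  forall p, adjs (ideal_add I J) fs p <-> ideal_add (adjs I fs) (adjs J fs) p.
Proof.
elim: fs I J => //= f fs IH I J hI hJ p.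
have := IH _ _ (is_ideal_adj f hI) (is_ideal_adj f hJ) p.
move=> [h1 h2]; split.
  by move=> h; apply/h1; exact: (iffLR (adjs_ext fs (adj_add f hI hJ) p) h).
by move=> /h2 h; exact: (iffRL (adjs_ext fs (adj_add f hI hJ) p) h).
Qed.

Lemma adjs_cap I J fs : is_ideal I -> is_ideal J -> wreg (ideal_add I J) fs ->
  forall p, adjs (ideal_cap I J) fs p <-> ideal_cap (adjs I fs) (adjs J fs) p.
Proof.
elim: fs I J => //= f fs IH I J hI hJ [hf hfs] p.
have h1 : wreg (ideal_add (adj I f) (adj J f)) fs.
  by apply: wreg_ext hfs; apply: adj_add.
have h2 := IH _ _ (is_ideal_adj f hI) (is_ideal_adj f hJ) h1 p.
split=> [h|/h2 h].
  by apply/h2; exact: (iffLR (adjs_ext fs (adj_cap hI hJ hf) p) h).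
by exact: (iffRL (adjs_ext fs (adj_cap hI hJ hf) p) h).
Qed.

Lemma nonzerodivisor_cap I J f : nonzerodivisor I f -> nonzerodivisor J f ->
  nonzerodivisor (ideal_cap I J) f.
Proof. by move=> h1 h2 g [/h1 ? /h2 ?]. Qed.

(** Regularity of [fs] on R/(I+J) makes [adj_cap] available at each step. For the last [f],
    regularity on both R/I and R/J suffices; this gains one element over R/(I+J). *)
Lemma wreg_cap I J fs f : is_ideal I -> is_ideal J ->
  wreg (ideal_add I J) fs -> wreg I (rcons fs f) -> wreg J (rcons fs f) ->
  wreg (ideal_cap I J) (rcons fs f).
Proof.
elim: fs I J => [|g fs IH] I J hI hJ /=.
  by move=> _ [h1 _] [h2 _]; split => //; apply: nonzerodivisor_cap.
move=> [hg hfs] [h1 h1s] [h2 h2s]; split; first exact: nonzerodivisor_cap.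
apply: wreg_ext (IH _ _ _ _ _ h1s h2s); try exact: is_ideal_adj.
  by move=> p; split=> /(adj_cap hI hJ hg).
by apply: wreg_ext hfs; apply: adj_add.
Qed.

(* The connecting map of the snake lemma for multiplication by [f] carries the
   socle element [u] of R/(I+J) to a socle element of R/((I n J) + f). *)
Lemma socle_cap I J (m : R -> Prop) f u : is_ideal I -> is_ideal J ->
  nonzerodivisor I f -> nonzerodivisor J f -> m f ->
  ~ ideal_add I J u -> (forall r, m r -> ideal_add I J (r * u)) ->
  exists2 w, ~ adj (ideal_cap I J) f w &
    forall r, m r -> adj (ideal_cap I J) f (r * w).
Proof.
move=> hI hJ h1 h2 mf hu hm; have [a ha hb] := hm _ mf.
(* With f u = a + b, a in I and b in J, the witness b represents the pair (f u, 0) of R/I x R/J,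
   that is, f times the lift (u, 0) of u. *)
exists (f * u - a).
  move=> [r [hr1 hr2]]; apply: hu; exists (u - r).
    apply: h1; have -> : f * (u - r) = (f * u - a - r * f) + a by ring.
    exact: idealD.
  have -> : u - (u - r) = r by ring.
  apply: h2; have -> : f * r = (f * u - a) - (f * u - a - r * f) by ring.
  exact: idealB.
move=> r /hm[a' ha' hb']; exists (r * u - a'); split.
  have -> : r * (f * u - a) - (r * u - a') * f = a' * f - r * a by ring.
  by apply: idealB => //; [apply: ideal_mulr | apply: ideal_mull].
by apply: idealB => //; [apply: ideal_mull | apply: ideal_mulr].
Qed.

End Ideals.

(** * Regular sequences and the socle *)

Section Koszul.
Variables (R : comNzRingType) (T : Type) (g : T -> R).
Implicit Types (I : R -> Prop) (c b : seq T -> R) (i : nat).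

(* The Koszul differential of the family [g] on not necessarily alternating
   cochains: its value at [j_0 .. j_i] is the sum over k of (-1)^k g_(j_k)
   times the value of [c] at the sequence with [j_k] deleted. The recursion is
   the homotopy formula [iota_j o kd + kd o iota_j = g_j], where [iota_j]
   inserts [j] in front. *)
Fixpoint kd c (s : seq T) : R :=
  if s is j :: s' then g j * c s' - kd (fun s => c (j :: s)) s' else 0.

Lemma kd_kd c s : kd (kd c) s = 0.
Proof.
elim: s c => [|j s IH] c //=.
have kdB c1 c2 a s1 : kd (fun s => a * c1 s - c2 s) s1 = a * kd c1 s1 - kd c2 s1.
  elim: s1 c1 c2 => [|k s1 IHs] c1 c2 /=; first by rewrite mulr0 subrr.
  by rewrite IHs; ring.
by rewrite (kdB c (kd (fun s => c (j :: s)))) IH; ring.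
Qed.

Lemma kdD c b s : kd (fun s => c s + b s) s = kd c s + kd b s.
Proof. by elim: s c b => [|j s IH] c b /=; rewrite ?addr0 // IH; ring. Qed.

Lemma kdZ a c s : kd (fun s => a * c s) s = a * kd c s.
Proof. by elim: s c => [|j s IH] c /=; rewrite ?mulr0 // IH; ring. Qed.

Lemma kd_ideal I c i : is_ideal I -> (forall s, size s = i -> I (c s)) ->
  forall s, size s = i.+1 -> I (kd c s).
Proof.
move=> hI; elim: i c => [|i IH] c h [|j s] //= [hs].
  case: s hs => //= _; rewrite subr0; apply: ideal_mull => //; exact: h.
apply: idealB => //; first by apply: ideal_mull => //; apply: h.
by apply: IH hs => s' hs'; apply: h; rewrite /= hs'.
Qed.

(** Vanishing of the cohomology of R/I in degree [i], expressed by congruences modulo I between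
    R-valued cochains. In degree 0 the only coboundary is zero. *)
Definition kvanish I i := forall c,
  (forall s, size s = i.+1 -> I (kd c s)) ->
  exists b, forall s, size s = i -> I (c s - kd b s).

Lemma adj_choice I f i c : (forall s, size s = i -> adj I f (c s)) ->
  exists b, forall s, size s = i -> I (c s - b s * f).
Proof.
move=> h; apply: functional_choice (fun s a => size s = i -> I (c s - a * f)) _.
move=> s; case: (eqVneq (size s) i) => [/h[a ha]|/eqP hs]; last by exists 0.
by exists a.
Qed.

(** The part H^i(R/I) -> H^i(R/(I+f)) -> H^(i+1)(R/I) of the long exact sequence for multiplication
    by f on R/I, with both ends zero. *)
Lemma kvanish_adj I f i : is_ideal I -> nonzerodivisor I f ->
  kvanish I i -> kvanish I i.+1 -> kvanish (adj I f) i.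
Proof.
move=> hI hf h0 h1 w hw.
have [t ht] := adj_choice hw.
(* As kd w = t f modulo I, also f (kd t) = kd (kd w) = 0, so t is a cocycle. Once t = kd e, the
   cochain w - f e is a cocycle modulo I. *)
have [|e he] := h1 t.
  move=> s hs; apply: hf.
  have := kd_ideal hI ht hs.
  have := kdD (kd w) (fun s => (- f) * t s) s.
  rewrite kdZ kd_kd => hE; move=> h.
  have -> : f * kd t s = - (0 + - f * kd t s) by ring.
  rewrite -hE; apply: idealN => //; apply: kd_ideal hs => // s' hs'.
  by rewrite mulNr mulrC; apply: ht.
have [|z hz] := h0 (fun s => w s + (- f) * e s).
  move=> s hs; rewrite (kdD w (fun s => - f * e s)) kdZ.
  have -> : kd w s + - f * kd e s =
    (kd w s - t s * f) + f * (t s - kd e s) by ring.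
  by apply: idealD; [|apply: ht|apply: ideal_mull => //; apply: he].
exists z => s /hz h; exists (e s).
by have -> : w s - kd z s - e s * f = w s + - f * e s - kd z s by ring.
Qed.

Lemma kvanish0 I j : nonzerodivisor I (g j) -> kvanish I 0.
Proof.
move=> hj w hw; exists (fun=> 0) => -[] // _ /=; rewrite subr0; apply: hj.
by have := hw [:: j] erefl; rewrite /= subr0.
Qed.

(** For a cocycle w the homotopy formula gives g_j w = kd (w (j :: -)) modulo I. So w (j :: -) is a
    cocycle modulo g_j, hence of the form kd z + g_j x; applying kd and cancelling g_j leaves w = kd
    x. *)
Lemma kvanishS I j i : is_ideal I -> nonzerodivisor I (g j) ->
  kvanish (adj I (g j)) i -> kvanish I i.+1.
Proof.
move=> hI hj h w hw.
have hjw s : size s = i.+1 -> I (g j * w s - kd (fun s => w (j :: s)) s).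
  by move=> hs; apply: (hw (j :: s)); rewrite /= hs.
have [|z hz] := h (fun s => w (j :: s)).
  move=> s /hjw hs; exists (w s).
  have -> : kd (fun s => w (j :: s)) s - w s * g j =
    - (g j * w s - kd (fun s => w (j :: s)) s) by ring.
  exact: idealN.
have [x hx] := adj_choice hz.
exists x => s hs; apply: hj.
pose F s := (w (j :: s) + (-1) * kd z s) + (- g j) * x s.
have hF : I (kd F s).
  apply: kd_ideal hs => // s' /hx.
  rewrite /F; have -> // : w (j :: s') + -1 * kd z s' + - g j * x s' =
    w (j :: s') - kd z s' - x s' * g j by ring.
have hE : kd F s = kd (fun s => w (j :: s)) s - g j * kd x s.
  rewrite /F (kdD (fun s => w (j :: s) + _)) (kdD (fun s => w (j :: s))) !kdZ.
  by rewrite kd_kd; ring.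
have -> : g j * (w s - kd x s) =
  (g j * w s - kd (fun s => w (j :: s)) s) + kd F s by rewrite hE; ring.
by apply: idealD => //; apply: hjw.
Qed.

Lemma wreg_kvanish I (js : seq T) i : is_ideal I -> wreg I (map g js) ->
  (i < size js)%N -> kvanish I i.
Proof.
elim: js I i => //= j js IH I [|i] hI [hj hjs].
  by move=> _; apply: kvanish0 hj.
rewrite ltnS => hi; apply: kvanishS hj _ => //.
by apply: IH => //; apply: is_ideal_adj.
Qed.

(** Each element of [fs] costs one degree in the long exact sequence, hence the bound
    [i + size fs]. *)
Lemma kvanish_adjs I fs i : is_ideal I -> wreg I fs ->
  (forall k, (k <= i + size fs)%N -> kvanish I k) -> kvanish (adjs I fs) i.
Proof.
elim: fs I => [|f fs IH] I hI /= => [_|[hf hfs]] h; first by apply: h; lia.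
apply: IH => //; first exact: is_ideal_adj.
by move=> k hk; apply: kvanish_adj => //; apply: h; lia.
Qed.

End Koszul.

(** A socle element of R/(I+fs) is a degree 0 cocycle for the family [gs]. If [gs] were longer than
    [fs], the cohomology of R/I would vanish up to degree [size fs], hence that of R/(I+fs) in
    degree 0, and the socle element would be zero. *)
Lemma wreg_socle_size (R : comNzRingType) (I m : R -> Prop) (fs gs : seq R) u :
  is_ideal I -> wreg I fs -> wreg I gs -> (forall f, f \in gs -> m f) ->
  ~ adjs I fs u -> (forall r, m r -> adjs I fs (r * u)) ->
  (size gs <= size fs)%N.
Proof.
move=> hI hfs hgs hm hu hmu; rewrite leqNgt; apply/negP => hlt; apply: hu.
have hv : kvanish (tnth (in_tuple gs)) (adjs I fs) 0.
  apply: kvanish_adjs => // k hk.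
  apply: (@wreg_kvanish _ _ _ _ (enum 'I_(size gs))) => //.
    by rewrite map_tnth_enum.
  by rewrite size_enum_ord; apply: leq_ltn_trans hlt.
have [|b /(_ [::] erefl)] := hv (fun=> u); last by rewrite /= subr0.
move=> [|j []] //= _; rewrite subr0; apply/hmu/hm/mem_tnth.
Qed.

(** The socle element of [socle_cap] serves twice: it shows that the quotient by the whole sequence
    is nonzero, and it bounds all regular sequences through [wreg_socle_size]. *)
Lemma depth_quotient_cap (R : comNzRingType) (I J A m : R -> Prop)
    (fs : seq R) f u :
  is_ideal I -> is_ideal J -> (forall p, A p <-> ideal_cap I J p) ->
  is_ideal A -> (forall g, g \in rcons fs f -> m g) ->
  wreg (ideal_add I J) fs -> wreg I (rcons fs f) -> wreg J (rcons fs f) ->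
  ~ adjs (ideal_add I J) fs u ->
  (forall r, m r -> adjs (ideal_add I J) fs (r * u)) ->
  depth_quotient_eq m A (size fs).+1.
Proof.
move=> hI hJ hA iA hm hw hwI hwJ hu hmu.
have iI := is_ideal_adjs fs hI; have iJ := is_ideal_adjs fs hJ.
have hwA : wreg A (rcons fs f).
  by apply: (wreg_ext (I := ideal_cap I J)); [split=> /hA | apply: wreg_cap].
have [|||||w hw1 hw2] := @socle_cap _ _ _ m f u iI iJ.
- by have /wreg_rcons[] := hwI.
- by have /wreg_rcons[] := hwJ.
- by apply: hm; rewrite mem_rcons inE eqxx.
- by move=> /(adjs_add fs hI hJ).
- by move=> r /hmu /(adjs_add fs hI hJ).
have hE p : adjs A (rcons fs f) p <->
    adj (ideal_cap (adjs I fs) (adjs J fs)) f p.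
  rewrite -cats1 adjs_cat /=; split; apply: adj_mono => q.
    by move=> /(adjs_ext fs hA)/(adjs_cap hI hJ hw).
  by move=> /(adjs_cap hI hJ hw)/(adjs_ext fs hA).
split.
  exists (rcons fs f); split => //; first by rewrite size_rcons.
  apply: wreg_regular_seq => // h1; apply: hw1; apply/hE.
  by rewrite -[w]mulr1; apply: ideal_mull h1; apply: is_ideal_adjs.
move=> gs hgs /(regular_seq_wreg iA) hwg; rewrite -(size_rcons fs f).
apply: (wreg_socle_size (u := w)) hwA hwg hgs _ _ => //; first by move=> /hE.
by move=> r /hw2 /hE.
Qed.

(** * Substitutions and gradings *)

Section Polynomials.
Variables (K : fieldType) (n : nat).
Local Notation S := {mpoly K[n + n]}.
Implicit Types (I : S -> Prop) (p q r : S) (i j k : nat).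

(** Indices are natural numbers and variables out of range are 0, so that shifted indices such as in
    x_(j+1) carry no bound condition. *)
Definition x k : S := if insub k is Some i then xvar K i else 0.
Definition y k : S := if insub k is Some i then yvar K i else 0.

Lemma xE (i : 'I_n) : x i = xvar K i. Proof. by rewrite /x valK. Qed.
Lemma yE (i : 'I_n) : y i = yvar K i. Proof. by rewrite /y valK. Qed.

Lemma x_out k : (n <= k)%N -> x k = 0.
Proof. by move=> h; rewrite /x insubF // ltnNge h. Qed.
Lemma y_out k : (n <= k)%N -> y k = 0.
Proof. by move=> h; rewrite /y insubF // ltnNge h. Qed.

Lemma S_ind (P : S -> Prop) : (forall c, P c%:MP) ->
  (forall k, (k < n)%N -> P (x k)) -> (forall k, (k < n)%N -> P (y k)) ->
  (forall p q, P p -> P q -> P (p + q)) ->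
  (forall p q, P p -> P q -> P (p * q)) -> forall p, P p.
Proof.
move=> hC hx hy hD hM.
have hX m : P 'X_[m].
  rewrite mpolyXE_id; apply: (big_ind P) => //; first exact: (hC 1).
  move=> i _; elim: (m i) => [|e IH]; first exact: (hC 1).
  rewrite exprS; apply: hM => //.
  rewrite -[i]splitK; case: split => j /=.
    by have := hx j (ltn_ord j); rewrite xE.
  by have := hy j (ltn_ord j); rewrite yE.
elim/mpolyind => [|c m p _ _ IH]; first by have := hC 0; rewrite mpolyC0.
by apply: hD => //; rewrite -mul_mpolyC; apply: hM.
Qed.

Definition const : {rmorphism K -> S} := @mpolyC (n + n) K.

Section Substitution.
Variables (T : comNzRingType) (f : {rmorphism K -> T}) (a b : nat -> T).

Lemma subst_exists : {phi : {rmorphism S -> T} |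
  [/\ forall c, phi c%:MP = f c,
      forall k, (k < n)%N -> phi (x k) = a k
    & forall k, (k < n)%N -> phi (y k) = b k]}.
Proof.
pose h (i : 'I_(n + n)) :=
  match split i with inl j => a (val j) | inr j => b (val j) end.
exists (mmap f h); split=> [c|k hk|k hk]; first exact: mmapC.
  rewrite -[k]/(val (Ordinal hk)) xE /= mmapX mmap1U /h.
  by rewrite -[lshift _ _]/(unsplit (inl _)) unsplitK.
rewrite -[k]/(val (Ordinal hk)) yE /= mmapX mmap1U /h.
by rewrite -[rshift _ _]/(unsplit (inr _)) unsplitK.
Qed.

Definition subst : {rmorphism S -> T} := sval subst_exists.

Lemma substC c : subst c%:MP = f c.
Proof. by rewrite /subst; case: subst_exists => phi []. Qed.

Lemma subst_x k : (k < n)%N -> subst (x k) = a k.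
Proof. by rewrite /subst; case: subst_exists => phi [? + ?]; apply. Qed.

Lemma subst_y k : (k < n)%N -> subst (y k) = b k.
Proof. by rewrite /subst; case: subst_exists => phi [? ? +]; apply. Qed.

End Substitution.

Lemma rmorph_S_ext (T : nzRingType) (f g : {rmorphism S -> T}) :
  (forall c, f c%:MP = g c%:MP) ->
  (forall k, (k < n)%N -> f (x k) = g (x k)) ->
  (forall k, (k < n)%N -> f (y k) = g (y k)) -> f =1 g.
Proof.
move=> hC hx hy; apply: S_ind => // p q hp hq; first by rewrite !rmorphD hp hq.
by rewrite !rmorphM hp hq.
Qed.

Lemma subst_ideal (a b : nat -> S) I : is_ideal I ->
  (forall k, (k < n)%N -> I (x k - a k)) ->
  (forall k, (k < n)%N -> I (y k - b k)) ->
  forall p, I (p - subst const a b p).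
Proof.
move=> hI hx hy; apply: S_ind => [c|k h|k h|p q hp hq|p q hp hq].
- by rewrite substC subrr; apply: ideal0.
- by rewrite subst_x //; apply: hx.
- by rewrite subst_y //; apply: hy.
- by rewrite rmorphD opprD addrACA; apply: idealD.
rewrite rmorphM; set p' := subst _ _ _ p in hp *; set q' := subst _ _ _ q in hq *.
have -> : p * q - p' * q' = (p - p') * q + p' * (q - q') by ring.
by apply: idealD => //; [apply: ideal_mulr|apply: ideal_mull].
Qed.

Lemma is_ideal_ker (T : nzRingType) (f : {rmorphism S -> T}) :
  is_ideal (fun p => f p = 0).
Proof.
split; first exact: rmorph0.
  by move=> p q hp hq; rewrite rmorphD hp hq addr0.
by move=> r p hp; rewrite rmorphM hp mulr0.
Qed.

(** The kernel of a map into a domain is prime, so every element outside it is a nonzerodivisor. *)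
Lemma nonzerodivisor_ker (T : idomainType) (f : {rmorphism S -> T}) I p :
  (forall q, I q <-> f q = 0) -> f p != 0 -> nonzerodivisor I p.
Proof.
move=> h hp q /h; rewrite rmorphM => /eqP.
by rewrite mulf_eq0 (negbTE hp) => /eqP /h.
Qed.

(** * The standard grading *)

Definition const_poly : {rmorphism K -> {poly S}} := polyC \o const.

(** Every variable is multiplied by an auxiliary T, so the coefficient of T^e in [rescale p] is the
    component of degree e of p. *)
Definition rescale : {rmorphism S -> {poly S}} :=
  subst const_poly (fun k => x k *: 'X) (fun k => y k *: 'X).

Definition homogeneous e p := rescale p = p *: 'X^e.
Definition graded I := forall p e, I p -> I (rescale p)`_e.

Lemma homogeneous_x k : homogeneous 1 (x k).
Proof.
rewrite /homogeneous; case: (ltnP k n) => h; first by rewrite /rescale subst_x.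
by rewrite x_out // rmorph0 scale0r.
Qed.

Lemma homogeneous_y k : homogeneous 1 (y k).
Proof.
rewrite /homogeneous; case: (ltnP k n) => h; first by rewrite /rescale subst_y.
by rewrite y_out // rmorph0 scale0r.
Qed.

Lemma homogeneousB e p q :
  homogeneous e p -> homogeneous e q -> homogeneous e (p - q).
Proof. by rewrite /homogeneous rmorphB /= => -> ->; rewrite scalerBl. Qed.

Lemma homogeneousM d e p q :
  homogeneous d p -> homogeneous e q -> homogeneous (d + e) (p * q).
Proof.
rewrite /homogeneous rmorphM /= => -> ->.
by rewrite -scalerAr -scalerAl scalerA mulrC exprD.
Qed.

Lemma rescale_sum p : p = \sum_(e < size (rescale p)) (rescale p)`_e.
Proof.
have hp : p = (rescale p).[1].
  pose f := horner_eval (1 : S) \o rescale.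
  apply: (@rmorph_S_ext _ idfun f) => [c|k h|k h] /=; rewrite /f /= /horner_eval.
  - by rewrite /rescale substC hornerC.
  - by rewrite homogeneous_x hornerZ hornerX mulr1.
  - by rewrite homogeneous_y hornerZ hornerX mulr1.
rewrite [LHS]hp horner_coef; apply: eq_bigr => i _.
by rewrite expr1n mulr1.
Qed.

Lemma graded_mem I p : is_ideal I -> (forall e, I (rescale p)`_e) -> I p.
Proof.
move=> hI h; rewrite [p]rescale_sum; apply: (big_ind I); first exact: ideal0.
  by move=> q r; apply: idealD.
by move=> i _.
Qed.

Lemma coef_rescaleB p q e :
  (rescale (p - q))`_e = (rescale p)`_e - (rescale q)`_e.
Proof. by rewrite rmorphB /= coefB. Qed.

Lemma rescale_mul e p q i : homogeneous e q ->
  (rescale (p * q))`_i = if (i < e)%N then 0 else (rescale p)`_(i - e) * q.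
Proof.
rewrite /homogeneous => hq; rewrite rmorphM /= hq -scalerAr coefZ coefMXn.
by case: ifP; rewrite ?mulr0 // mulrC.
Qed.

Lemma graded_gen (P : S -> Prop) : (forall p, P p -> exists e, homogeneous e p) ->
  graded (ideal_gen P).
Proof.
move=> hP p e [s hs ->]; rewrite rmorph_sum /= coef_sum.
apply: ideal_sum => [|c /hs hc]; first exact: is_ideal_gen.
have [d hd] := hP _ hc; rewrite (rescale_mul _ _ hd).
have hI := is_ideal_gen P.
by case: ifP => _; [apply: ideal0 | apply: ideal_mull => //; apply: mem_ideal_gen].
Qed.

Lemma graded_adj I e q :
  is_ideal I -> homogeneous e q -> graded I -> graded (adj I q).
Proof.
move=> hI hq h p i [a /(h _ i) ha].
exists (if (i < e)%N then 0 else (rescale a)`_(i - e)).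
move: ha.
rewrite coef_rescaleB.
rewrite (rescale_mul a i hq).
case: ifP => _.
  by rewrite mul0r.
by [].
Qed.

(* Iterating the hypothesis pushes an element of [N] into I + l^k for all k;
   as I is graded and l has positive degree, this suffices. *)
Lemma graded_descent I (N : S -> Prop) l : is_ideal I -> graded I ->
  homogeneous 1 l -> (forall p, N p -> exists2 q, N q & I (p - q * l)) ->
  forall p, N p -> I p.
Proof.
move=> hI hg hl h p hp; apply: graded_mem => // e.
elim: e p hp => [|e IH] p /h [q hq /hg hpq].
  by have := hpq 0; rewrite coef_rescaleB (rescale_mul _ _ hl) /= subr0.
have := hpq e.+1; rewrite coef_rescaleB (rescale_mul _ _ hl) /= subn1 /= => h1.
by apply/(ideal_congr hI h1); apply: ideal_mulr => //; apply: IH.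
Qed.

(** [l] moves past one [f] at a time. Regularity of [f] on S/I uses the grading: if f g is in I,
    then g = a l modulo I with f a again in I, and [graded_descent] applies. *)
Lemma wreg_rot I l fs : is_ideal I -> graded I -> homogeneous 1 l ->
  (forall f, f \in fs -> homogeneous 1 f) ->
  wreg I (l :: fs) -> wreg I (rcons fs l).
Proof.
elim: fs I => [|f fs IH] I hI hg hl hfs; first exact: id.
move=> /= [h1 [h2 h3]].
have hf : homogeneous 1 f by apply: hfs; rewrite inE eqxx.
split.
  apply: graded_descent hl _ => // g hfg.
  have [|a ha] := h2 g; first exact: adj_sub.
  exists a => //; apply: h1.
  have -> : l * (f * a) = f * g - f * (g - a * l) by ring.
  by apply: idealB => //; apply: ideal_mull.
apply: IH => //.
- exact: is_ideal_adj.
- exact: graded_adj hf hg.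
- by move=> g hg'; apply: hfs; rewrite inE hg' orbT.
split.
  (* From l a = b f, regularity of f modulo l gives b = c l, and l cancels in l (a - c f). *)
  move=> a [b hb].
  have [|c hc] := h2 b.
    exists a; have -> : f * b - a * l = - (l * a - b * f) by ring.
    exact: idealN.
  exists c; apply: h1.
  have -> : l * (a - c * f) = (l * a - b * f) + f * (b - c * l) by ring.
  by apply: idealD => //; apply: ideal_mull.
apply: wreg_ext h3 => p; split=> -[a [b h]]; exists b; exists a.
  by have -> : p - b * l - a * f = p - a * f - b * l by ring.
by have -> : p - b * f - a * l = p - a * l - b * f by ring.
Qed.
(** * Ideals of linear forms *)

Lemma subst_x_total (T : comNzRingType) (f : {rmorphism K -> T}) a b k :
  (forall i, (n <= i)%N -> a i = 0) -> subst f a b (x k) = a k.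
Proof.
move=> h; case: (ltnP k n) => hk; first by rewrite subst_x.
by rewrite x_out // rmorph0 h.
Qed.

Lemma subst_y_total (T : comNzRingType) (f : {rmorphism K -> T}) a b k :
  (forall i, (n <= i)%N -> b i = 0) -> subst f a b (y k) = b k.
Proof.
move=> h; case: (ltnP k n) => hk; first by rewrite subst_y.
by rewrite y_out // rmorph0 h.
Qed.

Definition link j : S := x j.+1 - y j.

Lemma homogeneous_link j : homogeneous 1 (link j).
Proof. by apply: homogeneousB; [apply: homogeneous_x|apply: homogeneous_y]. Qed.

(** Links of index at least [n] are 0, so for [e = n] the nonzero generators are variables; lowering
    [e] by one adjoins one link. *)
Inductive lin_generator a k e : S -> Prop :=
| LinX i of (i < a)%N : lin_generator a k e (x i)
| LinY i of (i < k)%N : lin_generator a k e (y i)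
| LinLink j of (e <= j)%N : lin_generator a k e (link j).

Definition lin_ideal a k e : S -> Prop := ideal_gen (lin_generator a k e).

Lemma is_ideal_lin a k e : is_ideal (lin_ideal a k e).
Proof. exact: is_ideal_gen. Qed.

Definition lin_x a i := if (i < a)%N then 0 else x i.
Definition lin_y a k e i :=
  if (i < k)%N then 0 else if (e <= i)%N then lin_x a i.+1 else y i.
(** Normal form modulo [lin_ideal a k e]: a link rewrites y_j as x_(j+1), which may itself be
    killed. *)
Definition lin_subst a k e : {rmorphism S -> S} :=
  subst const (lin_x a) (lin_y a k e).

Lemma lin_x_out a i : (n <= i)%N -> lin_x a i = 0.
Proof. by move=> h; rewrite /lin_x x_out //; case: ifP. Qed.

Lemma lin_y_out a k e i : (n <= i)%N -> lin_y a k e i = 0.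
Proof.
move=> h; rewrite /lin_y y_out // lin_x_out; last exact: leqW.
by do 2?case: ifP.
Qed.

Lemma lin_substX a k e i : lin_subst a k e (x i) = lin_x a i.
Proof. by apply: subst_x_total => j; apply: lin_x_out. Qed.

Lemma lin_substY a k e i : lin_subst a k e (y i) = lin_y a k e i.
Proof. by apply: subst_y_total => j; apply: lin_y_out. Qed.

Lemma lin_subst_ideal a k e p : lin_ideal a k e (p - lin_subst a k e p).
Proof.
have hI := is_ideal_lin a k e.
have hx i : lin_ideal a k e (x i - lin_x a i).
  rewrite /lin_x; case: ifP => hi; last by rewrite subrr; apply: ideal0.
  by rewrite subr0; apply/mem_ideal_gen/LinX.
apply: subst_ideal => // i hi; rewrite /lin_y; case: ifP => hik.
  by rewrite subr0; apply/mem_ideal_gen/LinY.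
case: ifP => hei; last by rewrite subrr; apply: ideal0.
have -> : y i - lin_x a i.+1 = (x i.+1 - lin_x a i.+1) - link i.
  by rewrite /link; ring.
by apply: idealB => //; apply/mem_ideal_gen/LinLink.
Qed.

Lemma lin_idealE a k e p : (k <= e)%N ->
  lin_ideal a k e p <-> lin_subst a k e p = 0.
Proof.
move=> hke; split=> [|h]; last by rewrite -[p]subr0 -h; apply: lin_subst_ideal.
apply: (ideal_gen_le (is_ideal_ker (lin_subst a k e))).
move=> _ [i hi|i hi|j hj].
- by rewrite lin_substX /lin_x hi.
- by rewrite lin_substY /lin_y hi.
- rewrite /link rmorphB /= lin_substX lin_substY /lin_y hj.
  (* As k <= e, a linked y_j is not among the killed ones, so it has the same image as x_(j+1). *)
  by rewrite ltnNge (leq_trans hke hj) subrr.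
Qed.

Lemma lin_ideal_link a k e : (k <= e < n)%N ->
  nonzerodivisor (lin_ideal a k e.+1) (link e).
Proof.
move=> /andP[hke hen]; apply: nonzerodivisor_ker.
  by move=> q; apply: lin_idealE; apply: leqW.
rewrite /link rmorphB /= lin_substX lin_substY /lin_y ltnn ltnNge hke /=.
(* Setting all x to 0 and all y to 1 detects that y_e survives in the link. *)
pose f := subst (idfun : {rmorphism K -> K}) (fun=> 0) (fun=> 1).
apply/eqP => /(congr1 f)/eqP; rewrite rmorphB rmorph0 /= [f (y e)]subst_y //.
have -> : f (lin_x a e.+1) = 0.
  rewrite /lin_x; case: ifP => _; first by rewrite rmorph0.
  case: (ltnP e.+1 n) => h; first by rewrite /f subst_x.
  by rewrite x_out // rmorph0.
by rewrite sub0r oppr_eq0 oner_eq0.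
Qed.

Lemma lin_ideal_adj a k e p :
  adj (lin_ideal a k e.+1) (link e) p <-> lin_ideal a k e p.
Proof.
split.
  apply: adj_le; first exact: is_ideal_lin.
    apply: ideal_gen_le; first exact: is_ideal_lin.
    move=> _ [i hi|i hi|j hj]; apply: mem_ideal_gen.
    - exact: LinX.
    - exact: LinY.
    - by apply: LinLink; apply: ltnW.
  by apply: mem_ideal_gen; apply: LinLink.
have hI := is_ideal_lin a k e.+1.
apply: ideal_gen_le; first exact: is_ideal_adj.
move=> _ [i hi|i hi|j hj].
- by apply/adj_sub/mem_ideal_gen/LinX.
- by apply/adj_sub/mem_ideal_gen/LinY.
- case: (ltngtP e j) hj => // [hlt|->] _; last by apply: adj_mem; apply: is_ideal_lin.
  by apply/adj_sub/mem_ideal_gen/LinLink.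
Qed.

(** * The links as a regular sequence *)

(** Highest index first, since [lin_ideal] acquires its links as [e] decreases. *)
Definition links k e : seq S := rev [seq link j | j <- iota k (e - k)].

Lemma mem_links k e f :
  f \in links k e -> exists2 j, (k <= j < e)%N & f = link j.
Proof.
rewrite mem_rev => /mapP[j]; rewrite mem_iota => hj ->; exists j => //; lia.
Qed.

Lemma links_mem k e j : (k <= j < e)%N -> link j \in links k e.
Proof. by move=> hj; rewrite mem_rev map_f // mem_iota; lia. Qed.

Lemma links0 k : links k k = [::].
Proof. by rewrite /links subnn. Qed.

Lemma links_cons k e : (k <= e)%N -> links k e.+1 = link e :: links k e.
Proof.
by move=> h; rewrite /links subSn // -addn1 iotaD map_cat rev_cat subnKC.
Qed.

Lemma links_rcons k e : (k < e)%N -> links k e = rcons (links k.+1 e) (link k).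
Proof. by move=> h; rewrite /links -(subnSK h) /= rev_cons. Qed.

Lemma size_links k e : size (links k e) = (e - k)%N.
Proof. by rewrite size_rev size_map size_iota. Qed.

Lemma lin_ideal_links a k e : (k <= e <= n)%N ->
  wreg (lin_ideal a k e) (links k e) /\
  forall p, adjs (lin_ideal a k e) (links k e) p <-> lin_ideal a k k p.
Proof.
elim: e => [|e IH] /andP[h1 h2].
  by move: h1; rewrite leqn0 => /eqP ->; rewrite links0.
case: (ltngtP k e.+1) h1 => // [h1|->] _; last by rewrite links0.
rewrite links_cons //=.
have [|hw ha] := IH; first by rewrite -ltnS h1 ltnW.
split; first split.
- by apply: lin_ideal_link; rewrite -ltnS h1.
- by apply: wreg_ext hw => p; split=> /lin_ideal_adj.
- move=> p; split=> h.
    by apply/ha; apply: (iffLR (adjs_ext _ _ _) h) => q; apply: lin_ideal_adj.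
  by move/ha: h => h; apply: (iffRL (adjs_ext _ _ _) h) => q; apply: lin_ideal_adj.
Qed.

(** * The ideal of 2-minors *)

Definition minor i j : S := x i * y j - x j * y i.

Lemma homogeneous_minor i j : homogeneous 2 (minor i j).
Proof.
by apply: homogeneousB; apply: (@homogeneousM 1 1);
  do ?[exact: homogeneous_x | exact: homogeneous_y].
Qed.

Inductive minor_generator k : S -> Prop :=
| MinorX i of (i < k)%N : minor_generator k (x i)
| MinorY i of (i < k)%N : minor_generator k (y i)
| Minor i j of (k <= i)%N & (k <= j)%N : minor_generator k (minor i j).

(* For k = 0 this is the binomial edge ideal of the complete graph; in general
   the vertices below k are deleted first. *)
Definition minor_ideal k : S -> Prop := ideal_gen (minor_generator k).

Lemma is_ideal_minor k : is_ideal (minor_ideal k).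
Proof. exact: is_ideal_gen. Qed.

Lemma graded_minor k : graded (minor_ideal k).
Proof.
apply: graded_gen => _ [i _|i _|i j _ _].
- by exists 1%N; apply: homogeneous_x.
- by exists 1%N; apply: homogeneous_y.
- by exists 2%N; apply: homogeneous_minor.
Qed.

Lemma minor_ideal_minor k i j : minor_ideal k (minor i j).
Proof.
have hI := is_ideal_minor k.
have [hi|hi] := ltnP i k.
  apply: idealB => //.
    by apply: ideal_mulr => //; apply/mem_ideal_gen/MinorX.
  by apply: ideal_mull => //; apply/mem_ideal_gen/MinorY.
have [hj|hj] := ltnP j k; last by apply/mem_ideal_gen/Minor.
apply: idealB => //.
  by apply: ideal_mull => //; apply/mem_ideal_gen/MinorY.
by apply: ideal_mulr => //; apply/mem_ideal_gen/MinorX.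
Qed.

Lemma minor_ideal_mono k l p : (k <= l)%N -> minor_ideal k p -> minor_ideal l p.
Proof.
move=> hkl; apply: ideal_gen_le; first exact: is_ideal_minor.
move=> _ [i hi|i hi|i j _ _]; last exact: minor_ideal_minor.
  by apply/mem_ideal_gen/MinorX/(leq_trans hi).
by apply/mem_ideal_gen/MinorY/(leq_trans hi).
Qed.

Lemma minor_ideal_add m p :
  ideal_add (minor_ideal 0) (lin_ideal m m n) p <-> minor_ideal m p.
Proof.
have h0 := is_ideal_minor 0; have hl := is_ideal_lin m m n; split.
  apply: ideal_add_le; first exact: is_ideal_minor.
    by move=> q; apply: minor_ideal_mono.
  apply: ideal_gen_le; first exact: is_ideal_minor.
  move=> _ [i hi|i hi|j hj].
  - exact/mem_ideal_gen/MinorX.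
  - exact/mem_ideal_gen/MinorY.
  - rewrite /link (x_out (leqW hj)) (y_out hj) subrr.
    by apply: ideal0; apply: is_ideal_minor.
apply: ideal_gen_le; first exact: is_ideal_add.
move=> _ [i hi|i hi|i j _ _].
- by apply: ideal_addr => //; apply/mem_ideal_gen/LinX.
- by apply: ideal_addr => //; apply/mem_ideal_gen/LinY.
- by apply: ideal_addl => //; apply: minor_ideal_minor.
Qed.

(** Applied when [sigma p = 0]: membership of p in I is then tested on multiples of generators,
    although a generator itself may lie outside I. *)
Lemma ideal_gen_subst (sigma : {rmorphism S -> S}) I (P : S -> Prop) :
  is_ideal I -> (forall g, P g -> forall c, I (c * g - sigma (c * g))) ->
  forall p, ideal_gen P p -> I (p - sigma p).
Proof.
move=> hI h p [s hs ->]; rewrite rmorph_sum -sumrB.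
by apply: ideal_sum => // c /hs /h; apply.
Qed.

Local Notation x_ideal k := (lin_ideal n k n).

Lemma x_idealX k i : x_ideal k (x i).
Proof.
have [hi|hi] := ltnP i n; first exact/mem_ideal_gen/LinX.
by rewrite x_out //; apply: ideal0; apply: is_ideal_lin.
Qed.

Lemma minor_x_ideal k p : minor_ideal k p -> x_ideal k p.
Proof.
have hI := is_ideal_lin n k n; apply: ideal_gen_le => // _ [i hi|i hi|i j _ _].
- exact: x_idealX.
- exact/mem_ideal_gen/LinY.
- by apply: idealB => //; apply: ideal_mulr => //; apply: x_idealX.
Qed.

(** A 2 x n matrix of rank at most one with x_k = 0 has either column k or the whole row of x's
    equal to zero; the two components express these cases. *)
Lemma minor_ideal_adj k p : (k < n)%N ->
  adj (minor_ideal k) (x k) p <->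
  ideal_cap (minor_ideal k.+1) (x_ideal k) p.
Proof.
move=> hk; have hl := is_ideal_lin n k n; have hm := is_ideal_minor k.+1.
have hI : is_ideal (adj (minor_ideal k) (x k)).
  exact/is_ideal_adj/is_ideal_minor.
split.
  apply: adj_le; first exact: is_ideal_cap.
    by move=> q hq; split; [apply: minor_ideal_mono hq|apply: minor_x_ideal].
  by split; [apply/mem_ideal_gen/MinorX|apply: x_idealX].
move=> [h1 h2].
(* Modulo x_k and the minors, x_i y_k = x_k y_i = 0. *)
have hY q : x_ideal k q -> adj (minor_ideal k) (x k) (q * y k).
  move=> [s hs ->]; rewrite mulr_suml; apply: ideal_sum => // c /hs hc.
  rewrite -mulrA; apply: ideal_mull => //; case: hc => [i _|i hi|j hj].
  - have -> : x i * y k = x k * y i - minor k i by rewrite /minor; ring.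
    apply: idealB => //; last exact/adj_sub/minor_ideal_minor.
    by apply: ideal_mulr => //; apply: adj_mem; apply: is_ideal_minor.
  - by apply: ideal_mulr => //; apply/adj_sub/mem_ideal_gen/MinorY.
  - rewrite /link (x_out (leqW hj)) (y_out hj) subrr mul0r; exact: ideal0.
have -> : p = p - lin_subst n k n p.
  by rewrite (iffLR (lin_idealE _ _ (ltnW hk)) h2) subr0.
apply: (ideal_gen_subst _ _ h1) => // _ [i hi|i hi|i j hi hj] c; rewrite rmorphM /=.
- rewrite lin_substX /lin_x (leq_trans hi hk) mulr0 subr0.
  apply: ideal_mull => //; move: hi; rewrite ltnS leq_eqVlt => /orP[/eqP ->|hi].
    by apply: adj_mem; apply: is_ideal_minor.
  exact/adj_sub/mem_ideal_gen/MinorX.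
(* The generator y_k is fixed by the substitution, so only its coefficient changes, by an element of
   [x_ideal k], and [hY] applies. *)
- rewrite lin_substY /lin_y; move: hi; rewrite ltnS leq_eqVlt => /orP[/eqP ->|hi].
    rewrite ltnn leqNgt hk /= -mulrBl; apply: hY; exact: lin_subst_ideal.
  rewrite hi mulr0 subr0; apply: ideal_mull => //.
  exact/adj_sub/mem_ideal_gen/MinorY.
- have x0 l : lin_subst n k n (x l) = 0.
    rewrite lin_substX /lin_x; case: ltnP => // h; exact: x_out.
  rewrite /minor rmorphB !rmorphM /= !x0 !mul0r subrr mulr0 subr0.
  by apply: ideal_mull => //; apply/adj_sub/minor_ideal_minor.
Qed.

(* The image of the pair (x_i, y_i) is u_i (s, t) with u_i = x_i, s = y_0 and
   t = y_1. *)
Definition segre k : {rmorphism S -> S} :=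
  subst const (fun i => if (i < k)%N then 0 else y 0 * x i)
              (fun i => if (i < k)%N then 0 else y 1 * x i).

Lemma segreX k i : segre k (x i) = if (i < k)%N then 0 else y 0 * x i.
Proof.
by apply: subst_x_total => j hj; rewrite x_out // mulr0; case: ifP.
Qed.

Lemma segreY k i : segre k (y i) = if (i < k)%N then 0 else y 1 * x i.
Proof.
by apply: subst_y_total => j hj; rewrite x_out // mulr0; case: ifP.
Qed.

Lemma minor_ideal_segre k p : minor_ideal k p -> segre k p = 0.
Proof.
apply: (ideal_gen_le (is_ideal_ker (segre k))).
move=> _ [i hi|i hi|i j hi hj].
- by rewrite segreX hi.
- by rewrite segreY hi.
- rewrite /minor rmorphB !rmorphM /= !segreX !segreY !ltnNge hi hj /=; ring.
Qed.

Lemma segre_succ k p : segre k p = 0 -> segre k.+1 p = 0.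
Proof.
pose f := subst const (fun i => if i == k then 0 else x i) y.
have fx i : f (x i) = if i == k then 0 else x i.
  by apply: subst_x_total => j hj; rewrite x_out //; case: ifP.
have fy i : f (y i) = y i by apply: subst_y_total => j; apply: y_out.
have e i : (i < k.+1)%N = (i == k) || (i < k)%N by rewrite ltnS leq_eqVlt.
have -> : segre k.+1 p = (f \o segre k) p.
  apply: rmorph_S_ext => [c|i _|i _] /=.
  - by rewrite /segre /f !substC.
  - rewrite !segreX e; case: (i < k)%N; first by rewrite orbT rmorph0.
    rewrite orbF rmorphM /= fx fy; case: eqP => _; rewrite ?mulr0 //.
  - rewrite !segreY e; case: (i < k)%N; first by rewrite orbT rmorph0.
    rewrite orbF rmorphM /= fx fy; case: eqP => _; rewrite ?mulr0 //.
by move=> /= ->; rewrite rmorph0.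
Qed.

Lemma segre_x_ideal k p : (1 < n)%N -> (k <= n)%N ->
  segre k p = 0 -> x_ideal k p.
Proof.
move=> hn hk h; apply/lin_idealE => //.
(* Specialising s = 0 and t = 1 in the parametrisation kills the x's and sends y_i to the parameter
   u_i, renamed y_i. *)
pose f := subst const (fun i => if (i < n)%N then y i else 0)
                      (fun i => if i == 1%N then 1 else 0).
have fx i : (i < n)%N -> f (x i) = y i by move=> hi; rewrite /f subst_x // hi.
have fy0 : f (y 0) = 0 by rewrite /f subst_y // ltnW.
have fy1 : f (y 1) = 1 by rewrite /f subst_y.
have -> : lin_subst n k n p = (f \o segre k) p.
  apply: rmorph_S_ext => [c|i hi|i hi] /=.
  - by rewrite /segre /f /lin_subst !substC.
  - rewrite segreX lin_substX /lin_x hi; case: ifP; rewrite ?rmorph0 // => _.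
    by rewrite rmorphM /= fy0 mul0r.
  - rewrite segreY lin_substY /lin_y; case: ifP; rewrite ?rmorph0 // => _.
    by rewrite leqNgt hi rmorphM /= fy1 fx // mul1r.
by rewrite /= h rmorph0.
Qed.

Lemma segre_xk_neq0 k : (k < n)%N -> segre k (x k) != 0.
Proof.
move=> hk; rewrite segreX ltnn.
pose f := subst (idfun : {rmorphism K -> K}) (fun=> 1) (fun=> 1).
apply/eqP => /(congr1 f)/eqP; rewrite rmorphM rmorph0 /= /f subst_x // subst_y.
  by rewrite mulr1 oner_eq0.
exact: leq_ltn_trans hk.
Qed.

(** Descending induction on k: an element of the kernel lies in both components of
    [minor_ideal_adj], hence equals a x_k modulo the ideal. As the target is a domain, a is in the
    kernel again, and [graded_descent] concludes. *)
Lemma minor_idealE k p : (1 < n)%N -> (k <= n)%N ->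
  minor_ideal k p <-> segre k p = 0.
Proof.
move=> hn hk; split; first exact: minor_ideal_segre.
have [l hl] : exists l, (l + k)%N = n by exists (n - k)%N; rewrite subnK.
elim: l k p hl hk => [|l IH] k p hl hk hp.
  rewrite -[p]subr0 -hp; apply: subst_ideal; first exact: is_ideal_minor.
    move=> i hi; have hik : (i < k)%N by rewrite -[k]add0n hl.
    by rewrite hik subr0; apply/mem_ideal_gen/MinorX.
  move=> i hi; have hik : (i < k)%N by rewrite -[k]add0n hl.
  by rewrite hik subr0; apply/mem_ideal_gen/MinorY.
have hkn : (k < n)%N by rewrite -hl addSn ltnS leq_addl.
apply: (graded_descent (N := fun p => segre k p = 0) (l := x k)) hp.
- exact: is_ideal_minor.
- exact: graded_minor.
- exact: homogeneous_x.
move=> q hq.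
have [a ha] : adj (minor_ideal k) (x k) q.
  apply/minor_ideal_adj => //; split.
    by apply: (IH _ _ _ hkn (segre_succ hq)); rewrite addnS.
  by apply: segre_x_ideal => //; apply: ltnW.
exists a => //; have := minor_ideal_segre ha.
rewrite rmorphB hq sub0r rmorphM /= => /eqP.
by rewrite oppr_eq0 mulf_eq0 (negbTE (segre_xk_neq0 hkn)) orbF => /eqP.
Qed.

Lemma minor_ideal_x k : (1 < n)%N -> (k < n)%N ->
  nonzerodivisor (minor_ideal k) (x k).
Proof.
move=> hn hk; apply: nonzerodivisor_ker (segre_xk_neq0 hk) => p.
by apply: minor_idealE => //; apply: ltnW.
Qed.

(** Modulo x_k the ideal is an intersection by [minor_ideal_adj], and [wreg_cap] applies with
    [link k] as last form: [x_ideal k] is covered by linear forms, [minor_ideal k.+1] by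
    induction. *)
Lemma minor_ideal_wreg k : (1 < n)%N -> (k < n)%N ->
  wreg (minor_ideal k) (x k :: links k n) /\
  wreg (minor_ideal k) (rcons (links k n) (x k)).
Proof.
move=> hn hk; suff h : wreg (minor_ideal k) (x k :: links k n).
  split=> //; apply: wreg_rot h.
  - exact: is_ideal_minor.
  - exact: graded_minor.
  - exact: homogeneous_x.
  - by move=> f /mem_links[j _ ->]; apply: homogeneous_link.
have [l hl] : exists l, (l + k.+1)%N = n by exists (n - k.+1)%N; rewrite subnK.
elim: l k hl hk => [|l IH] k hl hk; split; try exact: minor_ideal_x.
  have [|h _] := @lin_ideal_links n k n; first by rewrite ltnW /=.
  apply: wreg_ext h => p; split=> [h|/minor_ideal_adj[]//].
  apply/minor_ideal_adj => //; split => //.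
  move: h; apply: ideal_gen_le; first exact: is_ideal_minor.
  move=> _ [i hi|i hi|j hj]; first by apply/mem_ideal_gen/MinorX; rewrite -[k.+1]add0n hl.
    by apply/mem_ideal_gen/MinorY/ltnW.
  rewrite /link (x_out (leqW hj)) (y_out hj) subrr.
  by apply: ideal0; apply: is_ideal_minor.
have hk1 : (k.+1 < n)%N by rewrite -hl addSn ltnS leq_addl.
apply: (wreg_ext (I := ideal_cap (minor_ideal k.+1) (x_ideal k))).
  by move=> p; split=> /minor_ideal_adj; apply.
rewrite links_rcons //; apply: wreg_cap.
- exact: is_ideal_minor.
- exact: is_ideal_lin.
(* The sum of the two components is [x_ideal k.+1]. *)
- have [|h _] := @lin_ideal_links n k.+1 n; first by rewrite ltnW //=.
  apply: wreg_ext h => p; split.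
    apply: ideal_gen_le.
      by apply: is_ideal_add; [apply: is_ideal_minor|apply: is_ideal_lin].
    move=> _ [i hi|i hi|j hj].
    + by apply: ideal_addr; [apply: is_ideal_minor|apply: x_idealX].
    + by apply: ideal_addl; [apply: is_ideal_lin|apply/mem_ideal_gen/MinorY].
    + by apply: ideal_addr; [apply: is_ideal_minor|apply/mem_ideal_gen/LinLink].
  apply: ideal_add_le; first exact: is_ideal_lin.
    exact: minor_x_ideal.
  apply: ideal_gen_le; first exact: is_ideal_lin.
  move=> _ [i hi|i hi|j hj]; first exact: x_idealX.
    by apply/mem_ideal_gen/LinY/ltnW.
  exact/mem_ideal_gen/LinLink.
(* Modulo y_k the form [link k] is x_(k+1), the element supplied by induction. *)
- apply: (@wreg_rcons_congr _ _ _ (x k.+1)); first exact: is_ideal_minor.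
    have -> : x k.+1 - link k = y k by rewrite /link; ring.
    exact/mem_ideal_gen/MinorY.
  apply: wreg_rot; last by apply: IH => //; rewrite addnS.
  + exact: is_ideal_minor.
  + exact: graded_minor.
  + exact: homogeneous_x.
  + by move=> f /mem_links[j _ ->]; apply: homogeneous_link.
- by rewrite -links_rcons //; have [] := @lin_ideal_links n k n; rewrite // ltnW /=.
Qed.

(** * Regular sequence and socle element for the cone *)

Lemma links_cat k l e : (k <= l <= e)%N ->
  links k e = links l e ++ links k l.
Proof.
move=> h; rewrite /links -rev_cat -map_cat.
have -> : (e - k = (l - k) + (e - l))%N by lia.
by rewrite iotaD subnKC //; lia.
Qed.

Lemma x_neq0 i : (i < n)%N -> x i != 0.
Proof.
move=> hi; pose f := subst (idfun : {rmorphism K -> K}) (fun=> 1) (fun=> 1).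
apply/eqP => /(congr1 f)/eqP.
by rewrite rmorph0 /f subst_x // oner_eq0.
Qed.

(* [l] is one less than the number of vertices joined to all others. *)
Section Cone.
Variable l : nat.
Hypothesis hl : (l + 3 <= n)%N.

Local Notation last_form := (x 0 + y n.-2).

(** Together x_0 and the links from l on form a prefix of a regular sequence, so x_0 is regular
    modulo these links. Adding y_(n-2), nilpotent here, preserves this; on the linear component x_0
    vanishes and y_(n-2) takes over. *)
Lemma minor_ideal_cone_wreg :
  wreg (minor_ideal 0) (rcons (links l n) last_form).
Proof.
have [|| hw _] := @minor_ideal_wreg 0; [lia|lia|].
have hI := is_ideal_adjs (links l n) (is_ideal_minor 0).
have : wreg (minor_ideal 0) (rcons (links l n) (x 0)).
  apply: wreg_rot.
  - exact: is_ideal_minor.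
  - exact: graded_minor.
  - exact: homogeneous_x.
  - by move=> f /mem_links[j _ ->]; apply: homogeneous_link.
  - have e : x 0 :: links 0 n = (x 0 :: links l n) ++ links 0 l.
      by rewrite /= -links_cat //; lia.
    by move: hw; rewrite e => /wreg_cat[].
move=> /wreg_rcons[h1 h2]; apply/wreg_rcons; split=> //.
apply: nonzerodivisor_add_sqr0 => //.
have e1 : n.-1.+1 = n by lia.
have e2 : n.-2.+1 = n.-1 by lia.
have hlink j : (l <= j < n)%N -> adjs (minor_ideal 0) (links l n) (link j).
  by move=> hj; apply: adjs_mem; [apply: is_ideal_minor | apply: links_mem].
(* The links give x_(n-1) = y_(n-2) and y_(n-1) = x_n = 0, so the last minor becomes -y_(n-2)^2. *)
have -> : y n.-2 * y n.-2 =
  - minor n.-2 n.-1 - x n.-2 * link n.-1 - y n.-2 * link n.-2.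
  by rewrite /minor /link e1 e2 [x n]x_out //; ring.
apply: idealB => //; last by apply: ideal_mull => //; apply: hlink; lia.
apply: idealB => //; last by apply: ideal_mull => //; apply: hlink; lia.
by apply: idealN => //; apply/adjs_sub/minor_ideal_minor.
Qed.

(** As y_l is zero here, [link l] acts as x_(l+1). The last form then acts as y_(n-2) = x_(n-1),
    which survives because n - 1 > l + 1. *)
Lemma lin_ideal_cone_wreg :
  wreg (lin_ideal l.+1 l.+1 n) (rcons (links l n) last_form).
Proof.
have [|hw ha] := @lin_ideal_links l.+1 l.+1 n; first lia.
rewrite links_rcons; last lia.
rewrite -cats1 -cats1 -catA; apply/wreg_cat; split=> //=.
have hx : nonzerodivisor (lin_ideal l.+1 l.+1 l.+1) (x l.+1).
  apply: nonzerodivisor_ker; first by move=> q; apply: lin_idealE.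
  by rewrite lin_substX /lin_x ltnn; apply: x_neq0; lia.
have hI := is_ideal_lin l.+1 l.+1 l.+1; have hI2 := is_ideal_lin l.+2 l.+1 l.+1.
have hI0 := is_ideal_lin l.+1 l.+1 n.
split.
  apply: (nonzerodivisor_ext (I := lin_ideal l.+1 l.+1 l.+1)).
    by move=> p; split=> /ha.
  apply: nonzerodivisor_congr hx => //.
  have -> : x l.+1 - link l = y l by rewrite /link; ring.
  exact/mem_ideal_gen/LinY.
split=> //; apply: (nonzerodivisor_ext (I := lin_ideal l.+2 l.+1 l.+1)).
  move=> p; split.
    apply: ideal_gen_le; first by apply/is_ideal_adj/is_ideal_adjs.
    have hsub q : lin_ideal l.+1 l.+1 l.+1 q ->
        adj (adjs (lin_ideal l.+1 l.+1 n) (links l.+1 n)) (link l) q.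
      by move=> hq; apply/adj_sub/ha.
    move=> _ [i hi|i hi|j hj]; last by apply/hsub/mem_ideal_gen/LinLink.
      move: hi; rewrite ltnS leq_eqVlt => /orP[/eqP ->|hi].
        have -> : x l.+1 = link l + y l by rewrite /link; ring.
        apply: idealD; first by apply/is_ideal_adj/is_ideal_adjs.
          by apply: adj_mem; apply: is_ideal_adjs.
        exact/hsub/mem_ideal_gen/LinY.
      exact/hsub/mem_ideal_gen/LinX.
    exact/hsub/mem_ideal_gen/LinY.
  apply: adj_le => // [q /ha|].
    apply: ideal_gen_le => // _ [i hi|i hi|j hj]; apply: mem_ideal_gen.
    - exact/LinX/ltnW.
    - exact/LinY.
    - exact/LinLink.
  by apply: idealB => //; apply: mem_ideal_gen; [apply: LinX|apply: LinY].
apply: nonzerodivisor_ker; first by move=> q; apply: lin_idealE.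
rewrite rmorphD /= lin_substX lin_substY /lin_x /lin_y /= add0r.
have -> : (n.-2 < l.+1)%N = false by lia.
have -> : (l < n.-2)%N by lia.
rewrite /lin_x; have -> : (n.-2.+1 < l.+2)%N = false by lia.
by apply: x_neq0; lia.
Qed.

Lemma minor_ideal_links_wreg : wreg (minor_ideal l.+1) (links l n).
Proof.
rewrite links_rcons; last lia.
have [||_ h] := @minor_ideal_wreg l.+1; [lia|lia|].
apply: wreg_rcons_congr h; first exact: is_ideal_minor.
have -> : x l.+1 - link l = y l by rewrite /link; ring.
exact/mem_ideal_gen/MinorY.
Qed.

Lemma max_ideal_x i : homogeneous_max_ideal (x i).
Proof.
have [hi|hi] := ltnP i n; last by rewrite x_out //; apply: ideal0; apply: is_ideal_gen.
rewrite -[i]/(val (Ordinal hi)) xE.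
by apply: mem_ideal_gen; exists (lshift n (Ordinal hi)).
Qed.

Lemma max_ideal_y i : homogeneous_max_ideal (y i).
Proof.
have [hi|hi] := ltnP i n; last by rewrite y_out //; apply: ideal0; apply: is_ideal_gen.
rewrite -[i]/(val (Ordinal hi)) yE.
by apply: mem_ideal_gen; exists (rshift n (Ordinal hi)).
Qed.

Lemma max_ideal_le I : is_ideal I -> (forall i, I (x i)) -> (forall i, I (y i)) ->
  forall p, homogeneous_max_ideal p -> I p.
Proof.
move=> hI hx hy; apply: ideal_gen_le => // _ [i ->].
rewrite -[i]splitK; case: split => j /=.
  by have := hx j; rewrite xE.
by have := hy j; rewrite yE.
Qed.

Lemma cone_forms_max f :
  f \in rcons (links l n) last_form -> homogeneous_max_ideal f.
Proof.
have hM : is_ideal (@homogeneous_max_ideal K (n + n)) by exact: is_ideal_gen.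
rewrite mem_rcons inE => /orP[/eqP ->|/mem_links[j _ ->]].
  by apply: idealD => //; [apply: max_ideal_x|apply: max_ideal_y].
by apply: idealB => //; [apply: max_ideal_x|apply: max_ideal_y].
Qed.

(** Modulo the sequence x_(l+1) = y_l = 0, so the minor of columns l+1 and i gives x_i y_(l+1) = 0;
    for i >= l the links turn y_i into x_(i+1). *)
Lemma minor_links_socle r : homogeneous_max_ideal r ->
  adjs (minor_ideal l.+1) (links l n) (r * y l.+1).
Proof.
set I := adjs _ _; have hm := is_ideal_minor l.+1.
have hI : is_ideal I by exact: is_ideal_adjs.
have hlink j : (l <= j < n)%N -> I (link j).
  by move=> hj; apply: adjs_mem => //; apply: links_mem.
have hx i : I (x i * y l.+1).
  have -> : x i * y l.+1 = (link l + y l) * y i - minor l.+1 i.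
    by rewrite /minor /link; ring.
  apply: idealB => //; last exact/adjs_sub/minor_ideal_minor.
  apply: ideal_mulr => //; apply: idealD => //; first by apply: hlink; lia.
  exact/adjs_sub/mem_ideal_gen/MinorY.
apply: (max_ideal_le (I := fun r => I (r * y l.+1))) => // [|i].
  split; first by rewrite mul0r; apply: ideal0.
    by move=> p q hp hq; rewrite mulrDl; apply: idealD.
  by move=> s p hp; rewrite -mulrA; apply: ideal_mull.
have [hin|hin] := ltnP i n; last by rewrite y_out // mul0r; apply: ideal0.
have [hi|hi] := ltnP i l.
  by apply: ideal_mulr => //; apply/adjs_sub/mem_ideal_gen/MinorY/ltnW.
have -> : y i * y l.+1 = x i.+1 * y l.+1 - link i * y l.+1.
  by rewrite /link; ring.
by apply: idealB => //; apply: ideal_mulr => //; apply: hlink; lia.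
Qed.

(** Sending x_(l+2) and y_(l+1) to T and all other variables to 0 kills the links and the variables
    in the ideal and puts every minor into (T^2), while y_(l+1) becomes T. *)
Lemma minor_links_y : ~ adjs (minor_ideal l.+1) (links l n) (y l.+1).
Proof.
pose f : {rmorphism S -> {poly K}} :=
  subst (@polyC K) (fun i => if i == l.+2 then 'X else 0)
    (fun i => if i == l.+1 then 'X else 0).
have fx i : f (x i) = if i == l.+2 then 'X else 0.
  by apply: subst_x_total => j hj; case: eqP => //; lia.
have fy i : f (y i) = if i == l.+1 then 'X else 0.
  by apply: subst_y_total => j hj; case: eqP => //; lia.
pose I p := exists q : {poly K}, f p = q * 'X^2.
have hI : is_ideal I.
  split; first by exists 0; rewrite rmorph0 mul0r.
    by move=> p q [a ha] [b hb]; exists (a + b); rewrite rmorphD mulrDl /= ha hb.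
  by move=> r p [a ha]; exists (f r * a); rewrite rmorphM /= ha mulrA.
have I0 p : f p = 0 -> I p by exists 0; rewrite mul0r.
move=> h; have [q] : I (y l.+1).
  move: h; apply: adjs_le => //; last first.
    move=> _ /mem_links[j hj ->]; apply: I0.
    by rewrite /link rmorphB /= fx fy eqSS subrr.
  apply: ideal_gen_le => // _ [i hi|i hi|i j hi hj].
  - by apply: I0; rewrite fx; case: eqP => //; lia.
  - by apply: I0; rewrite fy; case: eqP => //; lia.
  - rewrite /I /minor rmorphB !rmorphM /= !fx !fy.
    exists (((i == l.+2) && (j == l.+1))%:R - ((j == l.+2) && (i == l.+1))%:R).
    by do 4!case: eqP => _ /=; ring.
rewrite fy eqxx => /(congr1 (fun p : {poly K} => p`_1))/eqP.
by rewrite coefX coefMXn /= oner_eq0.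
Qed.

End Cone.

(** * The cone graph and its binomial edge ideal *)

Section ConeGraph.
Variables (l : nat) (hl : (l.+1 < n)%N).

Definition cone_edge : rel 'I_n :=
  fun v w => (v != w) && ((v <= l)%N || (w <= l)%N).

Lemma cone_edge_sym : ssrbool.symmetric cone_edge.
Proof. by move=> v w; rewrite /cone_edge eq_sym orbC. Qed.

Lemma cone_edge_irrefl : irreflexive cone_edge.
Proof. by move=> i; rewrite /cone_edge eqxx. Qed.

Let v0 : 'I_n := Ordinal (ltn_trans (ltn0Sn l) hl).
(** The vertex 1: here [0 < l.+1] is read as [1 <= l.+1]. *)
Let v1 : 'I_n := Ordinal (leq_ltn_trans (ltn0Sn l) hl).

Lemma cone_edge_not_isolated (v : 'I_n) : exists w, cone_edge v w.
Proof.
have [->|h] := eqVneq v v0; first by exists v1.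
by exists v0; rewrite /cone_edge h orbT.
Qed.

Definition cone_graph : graph 'I_n :=
  Graph cone_edge_sym cone_edge_irrefl cone_edge_not_isolated.

Lemma connected_cone : connected_graph cone_graph.
Proof.
have h (v : 'I_n) : connect cone_graph v v0.
  have [->|hv] := eqVneq v v0; first exact: connect0.
  by apply: connect1; rewrite /= /cone_edge hv orbT.
move=> v w; apply: connect_trans (h v) _.
by rewrite (sym_connect_sym cone_edge_sym); apply: h.
Qed.

Local Notation J := (@binomial_edge_ideal K n cone_graph).

Lemma cone_ideal_minor i j : (i <= l)%N -> J (minor i j).
Proof.
have hJ : is_ideal J by exact: is_ideal_gen.
have hedge (a b : 'I_n) : (a < b)%N -> (a <= l)%N -> J (minor a b).
  move=> hab ha; rewrite /minor !xE !yE; apply: mem_ideal_gen; exists a, b.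
  by split=> //; rewrite /= /cone_edge ha andbT neq_ltn hab.
move=> hil; have hi : (i < n)%N by lia.
have [hj|hj] := ltnP j n; last first.
  by rewrite /minor (x_out hj) (y_out hj) mulr0 mul0r subrr; apply: ideal0.
have [hij|hij|->] := ltngtP i j.
- exact: (hedge (Ordinal hi) (Ordinal hj)).
- have -> : minor i j = - minor j i by rewrite /minor; ring.
  apply: idealN => //; apply: (hedge (Ordinal hj) (Ordinal hi)) => //=; lia.
- by rewrite /minor subrr; apply: ideal0.
Qed.

(** Killing the variables of the vertices up to l fixes the minors of the other vertices and changes
    their coefficients by elements of the linear ideal. So it suffices that x_k and y_k, for k <= l,
    multiply these minors into J. *)
Lemma cone_idealE p :
  J p <-> ideal_cap (minor_ideal 0) (lin_ideal l.+1 l.+1 n) p.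
Proof.
have hJ : is_ideal J by exact: is_ideal_gen.
have hA := is_ideal_minor 0; have hB := is_ideal_lin l.+1 l.+1 n.
split.
  apply: ideal_gen_le; first exact: is_ideal_cap.
  move=> _ [i [j [hij /= /andP[_ hl' ->]]]]; rewrite -!xE -!yE; split.
    exact: minor_ideal_minor.
  have hx k : (k <= l)%N -> lin_ideal l.+1 l.+1 n (x k).
    by move=> hk; apply/mem_ideal_gen/LinX.
  have hy k : (k <= l)%N -> lin_ideal l.+1 l.+1 n (y k).
    by move=> hk; apply/mem_ideal_gen/LinY.
  have hi : (i <= l)%N by lia.
  apply: idealB => //; first by apply: ideal_mulr => //; apply: hx.
  by apply: ideal_mull => //; apply: hy.
move=> [h0 h1]; have hn : (l.+1 <= n)%N by apply: ltnW.
have -> : p = p - lin_subst l.+1 l.+1 n p.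
  by rewrite (iffLR (lin_idealE _ _ hn) h1) subr0.
apply: (ideal_gen_subst _ _ h0) => // _ [//|//|i j _ _] c; rewrite rmorphM /=.
have hkill k : (k <= l)%N ->
    lin_subst l.+1 l.+1 n (x k) = 0 /\ lin_subst l.+1 l.+1 n (y k) = 0.
  by move=> hk; rewrite lin_substX lin_substY /lin_x /lin_y ltnS hk.
have hfix k : (l < k)%N ->
    lin_subst l.+1 l.+1 n (x k) = x k /\ lin_subst l.+1 l.+1 n (y k) = y k.
  move=> hk; rewrite lin_substX lin_substY /lin_y /lin_x ltnNge hk /=.
  split=> //; case: (leqP n k) => // h; rewrite (y_out h) (x_out (leqW h)).
  by case: ifP.
have [hi|hi] := leqP i l.
  have [x0 y0] := hkill _ hi.
  rewrite {2}/minor rmorphB !rmorphM /= x0 y0 mul0r mulr0 subr0 mulr0 subr0.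
  by apply: ideal_mull => //; apply: cone_ideal_minor.
have [hj|hj] := leqP j l.
  have [x0 y0] := hkill _ hj.
  rewrite {2}/minor rmorphB !rmorphM /= x0 y0 mul0r mulr0 subr0 mulr0 subr0.
  have -> : minor i j = - minor j i by rewrite /minor; ring.
  by apply: ideal_mull => //; apply: idealN => //; apply: cone_ideal_minor.
have [xi yi] := hfix _ hi; have [xj yj] := hfix _ hj.
have -> : lin_subst l.+1 l.+1 n (minor i j) = minor i j.
  by rewrite /minor rmorphB !rmorphM /= xi yi xj yj.
rewrite -mulrBl; move: (c - _) (lin_subst_ideal l.+1 l.+1 n c) => q [s hs ->].
rewrite mulr_suml; apply: ideal_sum => // d /hs hd.
rewrite -mulrA; apply: ideal_mull => //; case: hd => [k hk|k hk|k hk].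
(* Expansion of the vanishing determinant with rows x, x, y and columns k, i, j; the vertex k is
   adjacent to both i and j. *)
- have -> : x k * minor i j = x i * minor k j - x j * minor k i.
    by rewrite /minor; ring.
  by apply: idealB => //; apply: ideal_mull => //; apply: cone_ideal_minor.
- have -> : y k * minor i j = y i * minor k j - y j * minor k i.
    by rewrite /minor; ring.
  by apply: idealB => //; apply: ideal_mull => //; apply: cone_ideal_minor.
- by rewrite /link (x_out (leqW hk)) (y_out hk) subrr mul0r; apply: ideal0.
Qed.

End ConeGraph.
End Polynomials.

Theorem theorem3p2 (K : fieldType) (t n : nat) (ht : (6 <= t)%N)
    (htn : (t <= n + 1)%N) :
  exists G : graph 'I_n,
    connected_graph G /\
    depth_quotient_eq (@homogeneous_max_ideal K (n + n))
      (@binomial_edge_ideal K n G) t.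
Proof.
(* Thus l + 1 = n + 2 - t vertices are joined to all others. *)
have [l hl] : exists l, (l + t = n + 1)%N by exists (n + 1 - t)%N; rewrite subnK.
have hl3 : (l + 3 <= n)%N by lia.
have hln : (l.+1 < n)%N by lia.
exists (cone_graph hln); split; first exact: connected_cone.
(* The sequence consists of n - l = t - 1 links and the last form. *)
have -> : t = (size (links K n l n)).+1 by rewrite size_links; lia.
have hadd p : adjs (ideal_add (@minor_ideal K n 0) (lin_ideal l.+1 l.+1 n))
    (links K n l n) p <-> adjs (minor_ideal l.+1) (links K n l n) p.
  by apply: adjs_ext => q; apply: minor_ideal_add.
apply: (depth_quotient_cap (I := minor_ideal 0) (J := lin_ideal l.+1 l.+1 n)
          (f := x K n 0 + y K n n.-2) (u := y K n l.+1)).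
- exact: is_ideal_minor.
- exact: is_ideal_lin.
- exact: cone_idealE.
- exact: is_ideal_gen.
- exact: cone_forms_max.
- have h := @minor_ideal_links_wreg K n l hl3.
  by apply: wreg_ext h => p; split=> /minor_ideal_add.
- exact: minor_ideal_cone_wreg.
- exact: lin_ideal_cone_wreg.
- by move=> /hadd; apply: minor_links_y.
- by move=> r hr; apply/hadd; apply: minor_links_socle.
Qed.
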